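(* Let $k$ be an indeterminate and define $$a(k)=5k^2-4k+4,\qquad b(k)=\tfrac{1}{2}k(k^2-4k+20),\qquad c(k)=\tfrac{1}{2}(k+2)(k^2-4).$$ Then the elliptic curve $$E:\ y^2=\big(x+a(k)b(k)\big)\big(x+b(k)c(k)\big)\big(x+a(k)c(k)\big)$$ over the rational function field $\mathbb{Q}(k)$ has torsion subgroup of its Mordell–Weil group isomorphic to $\mathbb{Z}/2\mathbb{Z}\times\mathbb{Z}/2\mathbb{Z}$.
   Context: The triple $(a(k),b(k),c(k))$ gives the sides of a triangle with rational sides and rational area $k$ (a Heron triangle) for suitable rational $k$. The curve degenerates (is singular) exactly when $k\in\{0,2,-2\}$, and these values are excluded. *)

(* Defs.v *)
From HB Require Import structures.
From mathcomp Require Import all_boot all_order all_algebra all_field.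
From mathcomp Require Import ring.

Set Implicit Arguments.
Unset Strict Implicit.
Unset Printing Implicit Defensive.

Import GRing.Theory.
Local Open Scope ring_scope.

(* In characteristic other than 2 the affine curve y^2 = f(x), with f a monic
   cubic, is smooth exactly when f is separable. *)
Record ellCurve (F : fieldType) := EllCurve {
  cubic :> {poly F};
  ell_char : 2%:R != 0 :> F;
  cubic_monic : cubic \is monic;
  cubic_size : size cubic = 4;
  cubic_separable : separable_poly cubic }.

Section Points.

Variables (F : fieldType) (E : ellCurve F).

(* [None] is the point at infinity. *)
Definition on_curve (P : option (F * F)) : bool :=
  if P is Some (x, y) then y ^+ 2 == E.[x] else true.

Record point := Point { point_val :> option (F * F); _ : on_curve point_val }.

HB.instance Definition _ := [isSub for point_val].
HB.instance Definition _ := [Choice of point by <:].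

Definition raw_add (P Q : option (F * F)) : option (F * F) :=
  match P, Q with
  | None, _ => Q
  | _, None => P
  | Some (x1, y1), Some (x2, y2) =>
      if (x1 == x2) && (y1 == - y2) then None else
      let lam := if x1 == x2 then (E^`()).[x1] / (2%:R * y1)
                 else (y2 - y1) / (x2 - x1) in
      let x3 := lam ^+ 2 - E`_2 - x1 - x2 in
      Some (x3, lam * (x1 - x3) - y1)
  end.

Lemma cubicE x : E.[x] = x ^+ 3 + E`_2 * x ^+ 2 + E`_1 * x + E`_0.
Proof.
have E3 : E`_3 = 1 by have /eqP := cubic_monic E; rewrite lead_coefE cubic_size.
by rewrite horner_coef cubic_size !big_ord_recl big_ord0 /= /bump /= E3; ring.
Qed.

Lemma cubic_derivE x : (E^`()).[x] = 3%:R * x ^+ 2 + 2%:R * E`_2 * x + E`_1.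
Proof.
have E3 : E`_3 = 1 by have /eqP := cubic_monic E; rewrite lead_coefE cubic_size.
have sE : (size E^`() <= 3)%N.
  have /lt_size_deriv : (E : {poly F}) != 0 by rewrite -size_poly_eq0 cubic_size.
  by rewrite cubic_size ltnS.
rewrite (horner_coef_wide _ sE) !big_ord_recl big_ord0 /= /bump /=.
by rewrite !coef_deriv E3; ring.
Qed.

Lemma raw_add_on_curve P Q :
  on_curve P -> on_curve Q -> on_curve (raw_add P Q).
Proof.
case: P => [[x1 y1]|]; case: Q => [[x2 y2]|] //= /eqP e1 /eqP e2.
case: (eqVneq x1 x2) => [ex|nx] /=; last first.
  set l := _ / _; apply/eqP.
  have d : x2 - x1 != 0 by rewrite subr_eq0 eq_sym.
  have ey : y2 = y1 + l * (x2 - x1) by rewrite /l divfK //; ring.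
  move: e1 e2; rewrite !cubicE; clearbody l; subst y2 => e1 e2.
  have a0 : E`_0 = y1 ^+ 2 - x1 ^+ 3 - E`_2 * x1 ^+ 2 - E`_1 * x1.
    by rewrite e1; ring.
  have a1 : E`_1 = 2%:R * y1 * l + l ^+ 2 * (x2 - x1)
     - (x2 ^+ 2 + x1 * x2 + x1 ^+ 2) - E`_2 * (x1 + x2).
    apply: (mulfI d); move: e2; rewrite a0 => e2.
    apply/eqP; rewrite -subr_eq0; apply/eqP.
    move/eqP: e2; rewrite eq_sym -subr_eq0 => /eqP e2; rewrite -[RHS]e2; ring.
  by rewrite a0 a1; ring.
case: (eqVneq y1 (- y2)) => //= ny; apply/eqP; subst x2.
have e : y1 = y2.
  have : (y1 - y2) * (y1 + y2) == 0 by rewrite -subr_sqr e1 e2 subrr.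
  by rewrite mulf_eq0 subr_eq0 addr_eq0 (negPf ny) orbF => /eqP.
subst y2.
have y0 : y1 != 0.
  by apply: contraNneq ny => ->; rewrite oppr0.
set l := _ / _.
have el : l * (2%:R * y1) = (E^`()).[x1].
  by rewrite /l divfK // mulf_neq0 // ell_char.
clearbody l; move: el e1; rewrite cubic_derivE !cubicE => el e1.
have a1 : E`_1 = l * (2%:R * y1) - 3%:R * x1 ^+ 2 - 2%:R * E`_2 * x1.
  by rewrite el; ring.
have a0 : E`_0 = y1 ^+ 2 - x1 ^+ 3 - E`_2 * x1 ^+ 2 - E`_1 * x1.
  by rewrite e1; ring.
by rewrite a0 a1; ring.
Qed.

Definition zerop : point := @Point None isT.

Definition addp (P Q : point) : point :=
  Point (raw_add_on_curve (valP P) (valP Q)).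

Definition mulp (n : nat) (P : point) : point := iter n (addp P) zerop.

Definition torsion (P : point) : Prop :=
  exists2 n : nat, (0 < n)%N & mulp n P = zerop.

End Points.

Definition heron_a (F : fieldType) (k : F) : F :=
  5%:R * k ^+ 2 - 4%:R * k + 4%:R.

Definition heron_b (F : fieldType) (k : F) : F :=
  2%:R^-1 * k * (k ^+ 2 - 4%:R * k + 20%:R).

Definition heron_c (F : fieldType) (k : F) : F :=
  2%:R^-1 * (k + 2%:R) * (k ^+ 2 - 4%:R).

Definition heron_cubic (F : fieldType) (k : F) : {poly F} :=
  ('X + (heron_a k * heron_b k)%:P) * ('X + (heron_b k * heron_c k)%:P)
    * ('X + (heron_a k * heron_c k)%:P).

Definition Qk : fieldType := {fraction {poly rat}}.

Definition kvar : Qk := FracField.tofrac 'X.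

Lemma heron_cubicE (F : fieldType) (k : F) :
  heron_cubic k = \prod_(z <- [:: - (heron_a k * heron_b k);
    - (heron_b k * heron_c k); - (heron_a k * heron_c k)]) ('X - z%:P).
Proof. by rewrite !big_cons big_nil mulr1 !polyCN !opprK mulrA. Qed.

Lemma Qk_char : 2%:R != 0 :> Qk.
Proof.
rewrite -(rmorph_nat (@FracField.tofrac {poly rat})) tofrac_eq0.
by rewrite -(rmorph_nat (@polyC rat)) polyC_eq0.
Qed.

Lemma heron_monic : heron_cubic kvar \is monic.
Proof. by rewrite heron_cubicE monic_prod_XsubC. Qed.

Lemma heron_size : size (heron_cubic kvar) = 4.
Proof. by rewrite heron_cubicE size_prod_XsubC. Qed.

Lemma heron_separable_morph (F : fieldType) (t : {rmorphism {poly rat} -> F}) :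
  injective t -> separable_poly (heron_cubic (t 'X)).
Proof.
move=> t_inj.
pose A : {poly rat} := 5%:R * 'X ^+ 2 - 4%:R * 'X + 4%:R.
pose B : {poly rat} := 'X * ('X ^+ 2 - 4%:R * 'X + 20%:R).
pose C : {poly rat} := ('X + 2%:R) * ('X ^+ 2 - 4%:R).
have t_neq0 p : p.[1] != 0 -> t p != 0.
  by apply: contraNneq; rewrite -(rmorph0 t) => /t_inj ->; rewrite horner0.
have h2 : 2%:R != 0 :> F.
  by rewrite -(rmorph_nat t); apply: t_neq0; rewrite hornerMn hornerC.
have aE : heron_a (t 'X) = t A.
  by rewrite /heron_a /A rmorphD rmorphB !rmorphM !rmorph_nat expr2.
have bE : heron_b (t 'X) = t B / 2%:R.
  rewrite /heron_b /B rmorphM rmorphD rmorphB !rmorphM !rmorph_nat.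
  by move: (t 'X) => k; field.
have cE : heron_c (t 'X) = t C / 2%:R.
  rewrite /heron_c /C rmorphM rmorphB rmorphD rmorphXn !rmorph_nat.
  by move: (t 'X) => k; field.
have hn n : (n%:R : {poly rat}).[1] = n%:R by rewrite hornerMn hornerC.
have A1 : A.[1] = 5%:R.
  by rewrite /A hornerD hornerD hornerN !hornerM !hn hornerX; ring.
have B1 : B.[1] = 17%:R.
  by rewrite /B hornerM hornerD hornerD hornerN !hornerM !hn hornerX; ring.
have C1 : C.[1] = - 9%:R.
  rewrite /C hornerM [X in X * _]hornerD [X in _ * X]hornerD hornerN.
  by rewrite !hornerM !hn hornerX; ring.
clearbody A B C.
have n1 : t (B * (2%:R * A - C)) != 0.
  by apply: t_neq0; rewrite hornerM hornerD hornerN ?hornerM ?hn A1 B1 C1.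
have n2 : t (A * (B - C)) != 0.
  by apply: t_neq0; rewrite hornerM hornerD hornerN ?hornerM ?hn A1 B1 C1.
have n3 : t (C * (B - 2%:R * A)) != 0.
  by apply: t_neq0; rewrite hornerM hornerD hornerN ?hornerM ?hn A1 B1 C1.
move: n1 n2 n3; rewrite !rmorphM !rmorphB !rmorphM !rmorph_nat.
rewrite heron_cubicE separable_prod_XsubC /= !inE negb_or aE bE cE andbT !eqr_opp.
move: (t A) (t B) (t C) => {aE bE cE} a b c n1 n2 n3.
apply/andP; split; first (apply/andP; split).
- apply: contraNneq n1 => e; apply/eqP.
  transitivity (4%:R * (a * (b / 2%:R) - b / 2%:R * (c / 2%:R))); first by field.
  by rewrite e subrr mulr0.
- apply: contraNneq n2 => e; apply/eqP.
  transitivity (2%:R * (a * (b / 2%:R) - a * (c / 2%:R))); first by field.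
  by rewrite e subrr mulr0.
- apply: contraNneq n3 => e; apply/eqP.
  transitivity (4%:R * (b / 2%:R * (c / 2%:R) - a * (c / 2%:R))); first by field.
  by rewrite e subrr mulr0.
Qed.

Lemma heron_separable : separable_poly (heron_cubic kvar).
Proof.
apply: (@heron_separable_morph Qk (@FracField.tofrac {poly rat})) => p q /eqP.
by rewrite tofrac_eq => /eqP.
Qed.

Definition heron_curve : ellCurve Qk :=
  EllCurve Qk_char heron_monic heron_size heron_separable.

(* Main.v *)
Require Import Defs.
From mathcomp Require Import all_boot all_order all_algebra all_field.
From mathcomp Require Import ring.

(** Write e for the three roots of the cubic. If R is torsion and 2R = (x, y),
    then every x - e is a square. Torsion points have polynomial x-coordinates:
    at a pole of x the point reduces, after rescaling, to a nonzero point of the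
    cusp Y^2 = X^3, whose smooth part is the additive group of a ring containing
    Q. Applied to 2R and 4R this gives polynomials with U^2 = x + bc,
    V^2 = x + ac, W^2 = x + ab such that U V W divides
    U^2 V^2 + U^2 W^2 + V^2 W^2 unless y = 0. Since U^2 - W^2 = b (c - a) and
    V^2 - W^2 = a (c - b) are squarefree, W is coprime to U V, hence constant,
    and V^2 = W^2 + a (c - b) has leading coefficient 15, which is not a
    rational square. When y = 0 a sign or the same leading coefficient gives the
    contradiction. So 2R = O. The group law enters only through
    P + (P + Q) = 2P + Q, which shows that 2R and 4R are torsion. *)

Set Implicit Arguments.
Unset Strict Implicit.
Unset Printing Implicit Defensive.

Import Order.TTheory GRing.Theory Num.Theory.
Local Open Scope ring_scope.


(** * Chord and tangent formulas, and doubling without full associativity *)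

Section Chords.

Variables (F : fieldType) (E : ellCurve F).

Lemma raw_add_chord x1 y1 x2 y2 l : x1 != x2 -> y2 - y1 = l * (x2 - x1) ->
  raw_add E (Some (x1, y1)) (Some (x2, y2)) =
  Some (l ^+ 2 - E`_2 - x1 - x2, l * (x1 - (l ^+ 2 - E`_2 - x1 - x2)) - y1).
Proof.
move=> n12 el; rewrite /= (negPf n12) /=.
by have -> : (y2 - y1) / (x2 - x1) = l by rewrite el mulfK // subr_eq0 eq_sym.
Qed.

Lemma raw_add_tangent x y l : y != 0 -> (E^`()).[x] = l * (2%:R * y) ->
  raw_add E (Some (x, y)) (Some (x, y)) =
  Some (l ^+ 2 - E`_2 - x - x, l * (x - (l ^+ 2 - E`_2 - x - x)) - y).
Proof.
move=> y0 el; have n2 := ell_char E.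
have ny : (y == - y) = false.
  by rewrite -subr_eq0 opprK -mulr2n -mulr_natl mulf_eq0 (negPf n2) (negPf y0).
by rewrite /= eqxx ny /= el mulfK // mulf_neq0.
Qed.

Lemma raw_add_opp x y : raw_add E (Some (x, y)) (Some (x, - y)) = None.
Proof. by rewrite /= eqxx opprK eqxx. Qed.

Lemma raw_add_oppl x y : raw_add E (Some (x, - y)) (Some (x, y)) = None.
Proof. by rewrite /= !eqxx. Qed.

Lemma cubic_simple_root x : E.[x] = 0 -> (E^`()).[x] != 0.
Proof.
move=> Ex0; have := cubic_separable E; rewrite separable_poly.unlock => cop.
by apply: (coprimep_root cop); apply/eqP.
Qed.

(* With [t2 = x2 - x1], [t3 = x3 - x1] and slopes [l] of the tangent at P and
   [m] of the chord PQ, the chords P(P+Q) and (2P)Q have slopes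
   [- m - t2 / (l - m)] and [- l - t2 / (l - m)]. *)
Lemma raw_add_double P Q : on_curve E P -> on_curve E Q ->
  raw_add E P (raw_add E P Q) = raw_add E (raw_add E P P) Q.
Proof.
have n2 := ell_char E.
case: P => [[x1 y1]|] // onP.
case: Q => [[x2 y2]|] onQ; last by case: (raw_add E (Some (x1, y1)) _) => // -[].
have e1 := eqP onP; have e2 := eqP onQ.
have [y10|ny1] := eqVneq y1 0.
  subst y1; have -> : raw_add E (Some (x1, 0)) (Some (x1, 0)) = None.
    by rewrite /= eqxx oppr0 eqxx.
  have [ex|nx] := eqVneq x1 x2.
    subst x2; have y20 : y2 = 0.
      by apply/eqP; rewrite -sqrf_eq0 e2 -e1 expr0n.
    by subst y2; rewrite /= eqxx oppr0 eqxx.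
  have d : x2 - x1 != 0 by rewrite subr_eq0 eq_sym.
  pose l := y2 / (x2 - x1).
  have ey : y2 = l * (x2 - x1) by rewrite /l divfK.
  rewrite (@raw_add_chord _ _ _ _ l) //; last by rewrite subr0.
  set x3 := _ - _ - _ - _.
  (* Translation by a point (e, 0) satisfies (x3 - e)(x2 - e) = f'(e), nonzero at a simple root, so
     [x3] differs from [x1]. *)
  have der : (x3 - x1) * (x2 - x1) = (E^`()).[x1].
    apply: (mulfI d); move: e1 e2; rewrite /x3 cubic_derivE !cubicE ey => e1 e2.
    have a0 : E`_0 = - (x1 ^+ 3 + E`_2 * x1 ^+ 2 + E`_1 * x1).
      by apply/eqP; rewrite -addr_eq0 addrC -e1 expr0n.
    move: e2; rewrite a0 exprMn => e2.
    transitivity (l ^+ 2 * (x2 - x1) ^+ 2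
                  - (x2 - x1) ^+ 2 * (E`_2 + x2 + x1 *+ 2)).
      by ring.
    by rewrite e2; ring.
  have n13 : x1 != x3.
    apply: contra_eqN der => /eqP <-; rewrite subrr mul0r eq_sym.
    by apply: cubic_simple_root; rewrite -e1 expr0n.
  rewrite (@raw_add_chord _ _ _ _ (- l)) //; last by ring.
  by congr (Some (_, _)); rewrite ?ey /x3; ring.
pose l := (E^`()).[x1] / (2%:R * y1).
have el : (E^`()).[x1] = l * (2%:R * y1) by rewrite /l divfK // mulf_neq0.
clearbody l.
rewrite [raw_add E _ (Some (x1, y1))](raw_add_tangent ny1 el).
set x4 := _ - _ - _ - _; set y4 := _ - y1.
(* Half the second derivative at [x1]: with T = x - x1 the cubic is T^3 + g T^2 + 2 y1 l T +
   y1^2. *)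
pose g := E`_2 + x1 *+ 3.
have x4E : x4 = x1 + (l ^+ 2 - g) by rewrite /x4 /g; ring.
have [ex|n12] := eqVneq x1 x2.
  subst x2; have : (y2 - y1) * (y2 + y1) == 0 by rewrite -subr_sqr e1 e2 subrr.
  rewrite mulf_eq0 subr_eq0 addr_eq0 => /orP[] /eqP ey; subst y2.
    rewrite (raw_add_tangent ny1 el) -/x4 -/y4.
    have [ex|n14] := eqVneq x1 x4.
      rewrite /y4 -ex subrr mulr0 add0r raw_add_opp.
      by rewrite raw_add_oppl.
    have d : x4 - x1 != 0 by rewrite subr_eq0 eq_sym.
    pose k := (y4 - y1) / (x4 - x1).
    have ek : y4 - y1 = k * (x4 - x1) by rewrite /k divfK.
    rewrite (@raw_add_chord _ _ _ _ k) // (@raw_add_chord _ _ _ _ k) 1?eq_sym //.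
      congr (Some (_, _)); first by ring.
      by rewrite -[y4](subrK y1) ek; ring.
    by rewrite -opprB ek; ring.
  rewrite raw_add_opp -[LHS]/(Some (x1, y1)).
  have [ex|n14] := eqVneq x4 x1.
    have ey : y4 = - y1 by rewrite /y4 ex subrr mulr0 add0r.
    rewrite ex ey; rewrite (@raw_add_tangent _ _ (- l)) ?oppr_eq0 //.
      by rewrite sqrrN -/x4 ex; congr (Some (_, _)); ring.
    by rewrite el; ring.
  rewrite (@raw_add_chord _ _ _ _ (- l)) //; last by rewrite /y4; ring.
  by rewrite /y4 /x4; congr (Some (_, _)); ring.
have d : x2 - x1 != 0 by rewrite subr_eq0 eq_sym.
pose m := (y2 - y1) / (x2 - x1).
have em : y2 - y1 = m * (x2 - x1) by rewrite /m divfK.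
clearbody m; rewrite (raw_add_chord n12 em).
set x3 := _ - _ - _ - _; set y3 := _ - y1.
pose t2 := x2 - x1; pose t3 := x3 - x1.
(* On the chord y = y1 + m T this leaves T^2 + (g - m^2) T + 2 y1 (l - m), with roots [t2] and [t3]:
   [key] is their product, [gE] their sum. *)
have key : 2%:R * y1 * (l - m) = t2 * t3.
  have a1 : E`_1 = l * (2%:R * y1) - 3%:R * x1 ^+ 2 - 2%:R * E`_2 * x1.
    by rewrite -el cubic_derivE; ring.
  have y2E : y2 = y1 + m * t2 by rewrite -em; ring.
  have : y2 ^+ 2 - y1 ^+ 2 = E.[x2] - E.[x1] by rewrite e1 e2.
  rewrite !cubicE a1 y2E => h; apply: (mulfI d); apply/eqP; rewrite -subr_eq0.
  move/eqP: h; rewrite eq_sym -subr_eq0; congr (_ == _).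
  by rewrite /t3 /t2 /x3; ring.
have gE : g = m ^+ 2 - t2 - t3 by rewrite /t2 /t3 /x3 /g; ring.
(* Here P + Q = -P and 2P = -Q, so both sides are the point at infinity. *)
have [e31|n31] := eqVneq x3 x1.
  have elm : l = m.
    move/eqP: key; rewrite /t3 e31 subrr mulr0 !mulf_eq0 (negPf n2) (negPf ny1).
    by rewrite subr_eq0 => /eqP.
  rewrite {1}e31 {1}/y3 e31 subrr mulr0 add0r raw_add_opp.
  have ex : x4 = x2.
    by rewrite x4E gE /t3 e31 elm /t2; ring.
  have -> : y4 = - y2 by rewrite /y4 ex -(subrK y1 y2) em elm; ring.
  by rewrite ex raw_add_oppl.
have t3n : t3 != 0 by rewrite subr_eq0.
have lm : l - m != 0.
  by apply: contra_eqN key => /eqP ->; rewrite mulr0 eq_sym mulf_neq0.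
pose r := t2 / (l - m).
have t2E : t2 = r * (l - m) by rewrite /r divfK.
have y1E : 2%:R * y1 = r * t3.
  by apply: (mulIf lm); rewrite key t2E; ring.
have y2E : y2 = y1 + m * t2 by rewrite -em; ring.
rewrite (@raw_add_chord _ _ _ _ (- m - r)) 1?eq_sym //; last first.
  transitivity (- (m * t3) - 2%:R * y1); first by rewrite /y3 /t3; ring.
  by rewrite y1E /t3; ring.
have x2E : x2 = x1 + t2 by rewrite /t2; ring.
have x3E : x3 = x1 + t3 by rewrite /t3; ring.
have AE : E`_2 = g - x1 *+ 3 by rewrite /g; ring.
have resE : forall k, k = - l - r ->
  Some ((- m - r) ^+ 2 - E`_2 - x1 - x3,
        (- m - r) * (x1 - ((- m - r) ^+ 2 - E`_2 - x1 - x3)) - y1) =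
  Some (k ^+ 2 - E`_2 - x4 - x2, k * (x4 - (k ^+ 2 - E`_2 - x4 - x2)) - y4).
  move=> k ->; rewrite /y4 AE x4E x2E x3E gE t2E; congr (Some (_, _)); first by ring.
  apply/eqP; rewrite -subr_eq0; apply/eqP.
  transitivity (r * t3 - 2%:R * y1); last by rewrite y1E subrr.
  by ring.
have [e42|n42] := eqVneq x4 x2; last first.
  rewrite (@raw_add_chord _ _ _ _ (- l - r)) //; first exact: resE.
  transitivity (2%:R * y1 + m * t2 + l * (x4 - x1)).
    by rewrite y2E /y4; ring.
  by rewrite y1E x4E x2E gE t2E; ring.
have t3E : t3 = m ^+ 2 - l ^+ 2.
  have : x4 - x2 = 0 by rewrite e42 subrr.
  rewrite x4E x2E gE => h; apply/eqP; rewrite -subr_eq0 -h.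
  by apply/eqP; ring.
have ey : y4 = y2.
  rewrite y2E /y4 e42 x2E; apply/eqP; rewrite -subr_eq0; apply/eqP.
  transitivity (- (l + m) * t2 - 2%:R * y1); first by ring.
  by rewrite y1E t2E t3E; ring.
(* Now 2P = Q. If Q had order 2, then P + Q = -P, which is excluded above; in the formulas this is
   [l = m]. *)
have [y20|ny2] := eqVneq y2 0.
  have := lm; rewrite -(mulrI_eq0 _ (mulfI d)) mulrBr -/t2 subr_eq0.
  have t2m : t2 * m = - y1 by apply/eqP; rewrite -addr_eq0 addrC mulrC -y2E y20.
  suff -> : t2 * l = - y1 by rewrite t2m eqxx.
  transitivity (- (r * t3) - t2 * m); first by rewrite t3E t2E; ring.
  by rewrite -y1E t2m; ring.
rewrite ey e42 (@raw_add_tangent _ _ (- l - r)) //; last first.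
  transitivity ((E^`()).[x1] + 2%:R * g * t2 + 3%:R * t2 ^+ 2).
    by rewrite !cubic_derivE x2E AE; ring.
  transitivity ((- l - r) * (2%:R * y1 + 2%:R * m * t2)); last by rewrite y2E; ring.
  by rewrite el y1E gE t3E t2E; ring.
by rewrite (resE (- l - r)) // e42 ey.
Qed.

End Chords.


Lemma mulp_double (F : fieldType) (E : ellCurve F) (P : point E) n :
  mulp n (addp P P) = mulp n.*2 P.
Proof.
elim: n => // n IHn; rewrite doubleS /mulp /= -/(mulp _ _) IHn.
by apply/val_inj; rewrite /= (raw_add_double (valP P) (valP (mulp n.*2 P))).
Qed.

Lemma torsion_double (F : fieldType) (E : ellCurve F) (P : point E) :
  torsion P -> torsion (addp P P).
Proof.
case=> n n_gt0 nP; exists n => //.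
by rewrite mulp_double -addnn /mulp iterD -/(mulp n P) nP.
Qed.

(** * Reduction at a place and multiples of a point in its kernel *)

(* [red x q] reads: x is integral at the place and its residue is the rational
   number q. *)
Record rational_place (F : fieldType) (red : F -> rat -> Prop) : Prop := {
  red1 : red 1 1;
  redD : forall x y q r, red x q -> red y r -> red (x + y) (q + r);
  redN : forall x q, red x q -> red (- x) (- q);
  redM : forall x y q r, red x q -> red y r -> red (x * y) (q * r);
  red_neq0 : forall x q, red x q -> q != 0 -> x != 0;
  redV : forall x q, red x q -> q != 0 -> red x^-1 q^-1 }.

Section KernelOfReduction.

Variables (F : fieldType) (E : ellCurve F) (red : F -> rat -> Prop).
Hypothesis redP : rational_place red.

Lemma redB x y q r : red x q -> red y r -> red (x - y) (q - r).
Proof. by move=> xq yr; apply: (redD redP) => //; apply: (redN redP). Qed.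

Lemma red_nat n : red n.+1%:R n.+1%:R.
Proof.
elim: n => [|n IHn]; first exact: red1.
by rewrite -![n.+2%:R]natr1; apply: (redD redP) => //; apply: (red1 redP).
Qed.

(* After rescaling by [s] the curve reduces to the cusp Y^2 = X^3, whose smooth
   locus is the additive group by (X, Y) |-> X / Y; the multiples of the point
   of parameter 1 are the points (n^-2, n^-3). *)
Lemma mulp_cusp (P : point E) (s X Y : F) : s != 0 ->
    val P = Some (s ^+ 2 * X, s ^+ 3 * Y) -> red X 1 -> red Y 1 ->
    red (E`_2 / s ^+ 2) 0 -> red (E`_1 / s ^+ 4) 0 ->
  forall n, exists Xn Yn, [/\ val (mulp n.+1 P) = Some (s ^+ 2 * Xn, s ^+ 3 * Yn),
    red Xn (n.+1%:R ^- 2) & red Yn (n.+1%:R ^- 3)].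
Proof.
move=> s0 PE rX rY rA rB.
pose a := E`_2 / s ^+ 2; pose b := E`_1 / s ^+ 4.
have aE : E`_2 = s ^+ 2 * a by rewrite /a; field.
have bE : E`_1 = s ^+ 4 * b by rewrite /b; field.
rewrite -/a in rA; rewrite -/b in rB.
have h n : n.+1%:R != 0 :> rat by rewrite pnatr_eq0.
(* One addition in rescaled coordinates, for chord and tangent alike: the slope is [s * l], and the
   residues follow the addition formulas of the cusp. *)
have addE X2 Y2 l q q2 : raw_add E (Some (s ^+ 2 * X, s ^+ 3 * Y))
     (Some (s ^+ 2 * X2, s ^+ 3 * Y2)) =
     Some ((s * l) ^+ 2 - E`_2 - s ^+ 2 * X - s ^+ 2 * X2,
       s * l * (s ^+ 2 * X - ((s * l) ^+ 2 - E`_2 - s ^+ 2 * X - s ^+ 2 * X2))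
        - s ^+ 3 * Y) ->
   red X2 q2 -> red l q ->
   exists Xn Yn, [/\ raw_add E (Some (s ^+ 2 * X, s ^+ 3 * Y))
     (Some (s ^+ 2 * X2, s ^+ 3 * Y2)) = Some (s ^+ 2 * Xn, s ^+ 3 * Yn),
    red Xn (q ^+ 2 - 1 - q2) & red Yn (q * (1 - (q ^+ 2 - 1 - q2)) - 1)].
  move=> -> rX2 rl; pose X3 := l ^+ 2 - a - X - X2.
  exists X3, (l * (X - X3) - Y).
  have rX3 : red X3 (q ^+ 2 - 1 - q2).
    rewrite -[q ^+ 2]subr0; apply: redB => //; apply: redB => //.
    by apply: redB => //; rewrite !expr2; apply: (redM redP).
  split=> //; first by rewrite aE /X3; congr (Some (_, _)); ring.
  by apply: redB => //; apply: (redM redP) => //; apply: redB.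
case=> [|n].
  by exists X, Y; rewrite /mulp /= PE expr1n invr1.
(* The double needs the tangent, whose slope has residue 3/2 at (1, 1); every later multiple is
   reached by a chord. *)
elim: n => [|n [X2 [Y2 [PnE rX2 rY2]]]]; rewrite /mulp [iter _ _ _]/= -/(mulp _ _).
  have ny : s ^+ 3 * Y != 0 by rewrite mulf_neq0 ?expf_neq0 // (red_neq0 redP rY).
  pose l := (3%:R * X ^+ 2 + 2%:R * a * X + b) / (2%:R * Y).
  have Y0 : Y != 0 by apply: (red_neq0 redP rY).
  have [||Xn [Yn [vE rXn rYn]]] := addE X Y l (3%:R / 2%:R) 1 _ rX.
  - apply: raw_add_tangent => //; rewrite cubic_derivE aE bE /l.
    by have n2 := ell_char E; field; rewrite Y0.
  - apply: (redM redP) => //; last first.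
      apply: (redV redP) => //; rewrite -[X in red _ X]mulr1.
      by apply: (redM redP) => //; apply: red_nat.
    rewrite [X in red _ X](_ : _ = 3%:R * 1 ^+ 2 + 2%:R * 0 * 1 + 0) //.
    apply: (redD redP) => //; apply: (redD redP) => //; rewrite ?expr2; apply: (redM redP) => //.
    + exact: red_nat.
    + exact: redM.
    + by apply: (redM redP) => //; apply: red_nat.
  by exists Xn, Yn; rewrite /= PE.
(* The residues N^-2 and 1 of the two abscissas differ since N > 1 in characteristic zero, so the
   points are joined by a proper chord. *)
have n1 : n.+2%:R != 1 :> rat by rewrite pnatr_eq1.
set N : rat := n.+2%:R in n1 rX2 rY2 *.
have [N0 N1] : N != 0 /\ N + 1 != 0 by rewrite natr1 !h.
have NE : n.+3%:R = N + 1 by rewrite natr1.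
clearbody N; rewrite NE.
have NB : N - 1 != 0 by rewrite subr_eq0.
have d1 : 1 + -1 * N ^+ 2 != 0.
  rewrite [X in X != 0](_ : _ = - ((N - 1) * (N + 1))); last by ring.
  by rewrite oppr_eq0 mulf_neq0.
have d0 : N ^- 2 - 1 != 0.
  rewrite [X in X != 0](_ : _ = (1 + -1 * N ^+ 2) / N ^+ 2); last by field.
  by rewrite mulf_neq0 // invr_eq0 expf_neq0.
have rd : red (X2 - X) (N ^- 2 - 1) by apply: redB.
have dX : X2 - X != 0 by apply: (red_neq0 redP rd).
pose l := (Y2 - Y) / (X2 - X).
have [||Xn [Yn [vE rXn rYn]]] :=
  addE X2 Y2 l ((N ^- 3 - 1) / (N ^- 2 - 1)) (N ^- 2) _ rX2.
- apply: raw_add_chord.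
    by rewrite -subr_eq0 -mulrBr mulf_neq0 ?expf_neq0 // -opprB oppr_eq0.
  by rewrite /l; field.
- by apply: (redM redP); [apply: redB | apply: (redV redP)].
exists Xn, Yn; split; first by rewrite -vE -PE -PnE.
  by have := rXn; congr (red _ _); field; rewrite N0 N1.
by have := rYn; congr (red _ _); field; rewrite N0 N1.
Qed.

End KernelOfReduction.


(** * Rational functions and integrality of torsion abscissas *)

Lemma frac_numden (R : idomainType) (x : {fraction R}) :
  exists p q : R, q != 0 /\ x = FracField.tofrac p / FracField.tofrac q.
Proof.
elim/quotW: x => r; exists (frac r).1, (frac r).2; have d0 := denom_ratioP r.
split=> //; apply: (@mulIf _ (FracField.tofrac (frac r).2)).
  by rewrite tofrac_eq0.
rewrite divfK ?tofrac_eq0 //; apply/eqP.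
rewrite -[X in X == _]/(FracField.mul _ _) !piE /FracField.equivf.
by rewrite /FracField.mulf !numden_Ratio ?mulf_neq0 ?oner_neq0 // !mulr1 mulrC.
Qed.

(* An abstract copy of the field of rational functions: unification inside the
   quotient type [{fraction {poly rat}}] may not terminate in practice. *)
Section RationalFunctions.

Variables (F : fieldType) (t : {rmorphism {poly rat} -> F}).
Hypothesis t_inj : injective t.
Hypothesis t_frac : forall x, exists p q : {poly rat}, q != 0 /\ x = t p / t q.

Lemma embed_eq0 p : (t p == 0) = (p == 0).
Proof. by rewrite -(rmorph0 t) (inj_eq t_inj). Qed.

Lemma frac_coprime x :
  exists p q : {poly rat}, [/\ q != 0, coprimep p q & x = t p / t q].
Proof.
have [p [q [q0 ->]]] := t_frac x; pose g := gcdp p q.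
have g0 : g != 0 by rewrite gcdp_eq0 negb_and q0 orbT.
have pE : p = p %/ g * g by rewrite divpK ?dvdp_gcdl.
have qE : q = q %/ g * g by rewrite divpK ?dvdp_gcdr.
have qg0 : q %/ g != 0 by move: q0; rewrite {1}qE mulf_eq0 negb_or => /andP[].
exists (p %/ g), (q %/ g); split=> //.
  by rewrite coprimep_div_gcd // q0 orbT.
by rewrite {1}pE {1}qE !rmorphM invfM mulrACA divff ?mulr1 // embed_eq0.
Qed.

Lemma frac_const_den (p q : {poly rat}) : size q = 1 -> exists r, t p / t q = t r.
Proof.
move/eqP/size_poly1P=> [c c0 ->]; exists (p * (c^-1)%:P).
apply: (canLR (mulfK _)); first by rewrite embed_eq0 polyC_eq0.
by rewrite -rmorphM -mulrA -polyCM mulVf // mulr1.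
Qed.

(** The polynomial ring is integrally closed: in lowest terms n / m, the equation n^2 = p m^2 makes
    m coprime to itself, hence constant. *)
Lemma sqrt_poly x p : x ^+ 2 = t p -> exists q, x = t q.
Proof.
have [n [m [m0 cop ->]]] := frac_coprime x => e.
suff /frac_const_den h : size m = 1 by apply: h.
have mF : t m != 0 by rewrite embed_eq0.
have {}e : n ^+ 2 = p * m ^+ 2.
  apply: t_inj; rewrite rmorphM !rmorphXn -e expr_div_n divfK //.
  exact: expf_neq0.
apply/eqP; rewrite -coprimepp -(@coprimep_pexpl _ 2) //.
have := cop; rewrite -(@coprimep_pexpl _ 2 n) // e coprimepMl.
by case/andP.
Qed.

Section ReductionModulo.

Variable m : {poly rat}.
Hypothesis m_size : size m != 1.

(** The modulus need not be irreducible, so its residue ring may have zero divisors. Only residues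
    in Q are tracked: the nonzero ones are units. *)
Definition red_mod (x : F) (q : rat) : Prop :=
  exists p r : {poly rat}, [/\ coprimep r m, x = t p / t r & m %| p - q%:P * r].

Lemma coprime_mod_neq0 r : coprimep r m -> t r != 0.
Proof.
move=> cop; rewrite embed_eq0; apply: contraNneq m_size => r0.
by move: cop; rewrite r0 coprime0p -size_poly_eq1.
Qed.

Lemma red_mod_unit p r q : coprimep r m -> q != 0 ->
  m %| p - q%:P * r -> coprimep p m.
Proof.
move=> cop q0 /dvdpP[k e]; rewrite -(subrK (q%:P * r) p) e.
rewrite coprimep_sym coprimep_addl_mul mul_polyC coprimepZr //.
by rewrite coprimep_sym.
Qed.

Lemma red_modP : rational_place red_mod.
Proof.
split.
- exists 1, 1; rewrite coprime1p rmorph1 divr1; split=> //.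
  by rewrite mulr1 subrr dvdp0.
- move=> x y q q' [p [r [cop -> dv]]] [p' [r' [cop' -> dv']]].
  exists (p * r' + p' * r), (r * r'); split; first by rewrite coprimepMl cop.
    by rewrite addf_div ?coprime_mod_neq0 // -!rmorphM -rmorphD.
  have -> : p * r' + p' * r - (q + q')%:P * (r * r') =
    r' * (p - q%:P * r) + r * (p' - q'%:P * r') by rewrite polyCD; ring.
  by rewrite dvdp_add // dvdp_mull.
- move=> x q [p [r [cop -> dv]]]; exists (- p), r; split=> //.
    by rewrite rmorphN mulNr.
  have -> : - p - (- q)%:P * r = - (p - q%:P * r) by rewrite polyCN; ring.
  by rewrite dvdpNr.
- move=> x y q q' [p [r [cop -> dv]]] [p' [r' [cop' -> dv']]].
  exists (p * p'), (r * r'); split; first by rewrite coprimepMl cop.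
    by rewrite mulf_div -!rmorphM.
  have -> : p * p' - (q * q')%:P * (r * r') =
    p' * (p - q%:P * r) + q%:P * r * (p' - q'%:P * r') by rewrite polyCM; ring.
  by rewrite dvdp_add // dvdp_mull.
- move=> x q [p [r [cop -> dv]]] q0; rewrite mulf_neq0 ?invr_eq0 //.
    exact: coprime_mod_neq0 (red_mod_unit cop q0 dv).
  exact: coprime_mod_neq0.
- move=> x q [p [r [cop -> dv]]] q0; exists r, p.
  split; [exact: red_mod_unit dv | by rewrite invf_div |].
  have qV : (q^-1)%:P * q%:P = 1 :> {poly rat} by rewrite -polyCM mulVf.
  have -> : r - (q^-1)%:P * p = - (q^-1)%:P * (p - q%:P * r).
    by rewrite -[in LHS](mul1r r) -qV; ring.
  by rewrite dvdp_mull.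
Qed.

End ReductionModulo.

(* Were x = u / m with m nonconstant, P would lie in the kernel of reduction
   modulo m, which is torsion-free because the residue rings contain Q. *)
Lemma torsion_integral (E : ellCurve F) (a0 a1 a2 : {poly rat}) x y (P : point E) :
  E`_0 = t a0 -> E`_1 = t a1 -> E`_2 = t a2 ->
  val P = Some (x, y) -> torsion P -> exists p, x = t p.
Proof.
move=> E0 E1 E2 PE [n n_gt0 nP].
have [u [m [m0 cop xE]]] := frac_coprime x.
have [/frac_const_den h|m1] := eqVneq (size m) 1; first by rewrite xE; apply: h.
(* The numerator of y^2 = N / m^3; modulo m it is u^3, hence a unit. *)
pose N := u ^+ 3 + m * (a2 * u ^+ 2 + a1 * u * m + a0 * m ^+ 2).
have Nm : coprimep N m.
  rewrite /N addrC mulrC coprimep_sym coprimep_addl_mul coprimep_sym.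
  exact: coprimep_expl.
have u0 : t u != 0 by apply: coprime_mod_neq0 cop.
have N0 : t N != 0 by apply: coprime_mod_neq0 Nm.
have mF : t m != 0 by rewrite embed_eq0.
have y2 : y ^+ 2 = t N / t m ^+ 3.
  have := valP P; rewrite PE /= cubicE E0 E1 E2 xE => /eqP ->.
  by rewrite /N !(rmorphD, rmorphM, rmorphXn); field.
have y0 : y != 0.
  by rewrite -sqrf_eq0 y2 mulf_neq0 // invr_eq0 expf_neq0.
have x0 : x != 0 by rewrite xE mulf_neq0 ?invr_eq0.
(* With scale y / x both rescaled coordinates equal x^3 / y^2 = u^3 / N, which is 1 modulo m; so
   [rX] serves for both. *)
have s0 : y / x != 0 by rewrite mulf_neq0 ?invr_eq0.
have XE : x ^+ 3 / y ^+ 2 = t (u ^+ 3) / t N.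
  by rewrite y2 xE rmorphXn; field; rewrite N0.
have s2 : (y / x) ^+ 2 = t N / t (m * u ^+ 2).
  by rewrite expr_div_n y2 xE rmorphM rmorphXn; field; rewrite u0.
have rX : red_mod m (x ^+ 3 / y ^+ 2) 1.
  exists (u ^+ 3), N; split=> //.
  by rewrite /N mul1r opprD addrA subrr add0r dvdpNr dvdp_mulIl.
have [|||X' [Y' [e _ _]]] :=
  @mulp_cusp _ E _ (red_modP m1) P _ _ _ s0 _ rX rX _ _ n.-1.
- by rewrite PE; congr (Some (_, _)); field; rewrite ?x0 ?y0.
- exists (a2 * (m * u ^+ 2)), N; split=> //.
    by rewrite [t (a2 * _)]rmorphM E2 s2 invf_div mulrA.
  by rewrite polyC0 mul0r subr0 dvdp_mull ?dvdp_mulIl.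
- exists (a1 * (m * u ^+ 2) ^+ 2), (N ^+ 2); split; first exact: coprimep_expl.
    rewrite [t (a1 * _)]rmorphM [t (N ^+ 2)]rmorphXn.
    rewrite [t ((m * u ^+ 2) ^+ 2)]rmorphXn.
    by rewrite E1 (exprM _ 2 2) s2 expr_div_n invf_div mulrA.
  by rewrite polyC0 mul0r subr0 dvdp_mull // expr2 dvdp_mulr // dvdp_mulIl.
(* The n-th multiple is affine by reduction and infinite by torsion. *)
by move: e; rewrite prednK // nP.
Qed.

End RationalFunctions.

(** * Squarefreeness of the differences of roots *)

Lemma bezout_nat_coprimep (u v p q : {poly rat}) n :
  u * p + v * q = n.+1%:R -> coprimep p q.
Proof.
move=> e; apply/Bezout_coprimepP; exists (u, v); rewrite e.
by rewrite -(rmorph_nat (@polyC rat)) polyC_eqp1 pnatr_eq0.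
Qed.


(* This is 4 b (c - a); [separable_heron_acb] below is about a (c - b). *)
Lemma separable_heron_bca :
  separable_poly ('X * ('X ^+ 2 - 4%:R * 'X + 20%:R)
    * ('X ^+ 3 - 8%:R * 'X ^+ 2 + 4%:R * 'X - 16%:R) : {poly rat}).
Proof.
pose p : {poly rat} := 'X ^+ 2 - 4%:R * 'X + 20%:R.
pose q : {poly rat} := 'X ^+ 3 - 8%:R * 'X ^+ 2 + 4%:R * 'X - 16%:R.
have dp : p^`() = 2%:R * 'X - 4%:R.
  by rewrite /p !derivE; ring.
have dq : q^`() = 3%:R * 'X ^+ 2 - 16%:R * 'X + 4%:R.
  by rewrite /q !derivE; ring.
rewrite -/p -/q !separable_mul -!andbA separable_poly.unlock; apply/and5P; split.
- by rewrite derivX coprimep1.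
(* Each certificate is a Bezout identity with denominators cleared; its last argument is the
   constant less one, so 31 stands for 32. *)
- apply: (@bezout_nat_coprimep 2%:R (2%:R - 'X) _ _ 31).
  by rewrite dp /p; ring.
- apply: (@bezout_nat_coprimep (4%:R - 'X) 1 _ _ 19).
  by rewrite /p; ring.
- apply: (@bezout_nat_coprimep (39%:R * 'X - 250%:R)
           (- 13%:R * 'X ^+ 2 + 118%:R * 'X - 72%:R) _ _ 3711).
  by rewrite dq /q; ring.
rewrite coprimepMl; apply/andP; split.
  apply: (@bezout_nat_coprimep ('X ^+ 2 - 8%:R * 'X + 4%:R) (- 1) _ _ 15).
  by rewrite /q; ring.
apply: (@bezout_nat_coprimep (- 'X ^+ 2 + 6%:R * 'X + 24%:R) ('X - 2%:R) _ _ 511).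
by rewrite /p /q; ring.
Qed.

Lemma separable_heron_acb :
  separable_poly ((5%:R * 'X ^+ 2 - 4%:R * 'X + 4%:R)
    * (3%:R * 'X ^+ 2 - 12%:R * 'X - 4%:R) : {poly rat}).
Proof.
pose p : {poly rat} := 5%:R * 'X ^+ 2 - 4%:R * 'X + 4%:R.
pose q : {poly rat} := 3%:R * 'X ^+ 2 - 12%:R * 'X - 4%:R.
have dp : p^`() = 10%:R * 'X - 4%:R.
  by rewrite /p !derivE; ring.
have dq : q^`() = 6%:R * 'X - 12%:R.
  by rewrite /q !derivE; ring.
rewrite -/p -/q separable_mul separable_poly.unlock; apply/and3P; split.
- apply: (@bezout_nat_coprimep 10%:R (2%:R - 5%:R * 'X) _ _ 31).
  by rewrite dp /p; ring.
- apply: (@bezout_nat_coprimep (- 2%:R) ('X - 2%:R) _ _ 31).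
  by rewrite dq /q; ring.
apply: (@bezout_nat_coprimep (42%:R - 9%:R * 'X) (15%:R * 'X - 22%:R) _ _ 255).
by rewrite /p /q; ring.
Qed.


(** * The polynomial square equations have no solution *)

(** In n^2 = 15 d^2 the 5-adic valuation is even on the left and odd on the right. *)
Lemma rat_sqr_neq15 (q : rat) : q ^+ 2 != 15%:R.
Proof.
apply/eqP => e; have d0 : (denq q)%:~R != 0 :> rat by rewrite intr_eq0 denq_neq0.
have {}e : numq q ^+ 2 = 15%:R * denq q ^+ 2.
  apply: (@intr_inj rat); rewrite !expr2 !intrM -!expr2.
  rewrite -[15%:R%:~R]/(15%:R : rat) -e -[X in _ = X ^+ 2 * _](divq_num_den q).
  by rewrite expr_div_n divfK // expf_neq0.
have : (`|numq q| ^ 2 = 15 * `|denq q| ^ 2)%N by rewrite -!abszX e abszM.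
move/(congr1 (fun n => odd (logn 5 n))).
have dn : (0 < `|denq q|)%N by rewrite absz_gt0 denq_neq0.
by rewrite lognM ?expn_gt0 ?dn // !lognX oddD !oddM (_ : logn 5 15 = 1%N).
Qed.

(** The lower terms form an explicit list so that the degree bound is settled by computation. *)
Lemma sqr_lead_coef (p : {poly rat}) (c : rat) (s : seq rat) n :
  c != 0 -> (size s <= n)%N -> p ^+ 2 = c%:P * 'X ^+ n + Poly s ->
  lead_coef p ^+ 2 = c.
Proof.
move=> c0 sn /(congr1 lead_coef).
rewrite lead_coef_exp mul_polyC lead_coefDl ?lead_coefZ ?lead_coefXn ?mulr1 //.
by rewrite size_scale // size_polyXn ltnS (leq_trans (size_Poly s)).
Qed.

(** The square of the gcd of u and v divides u^2 - v^2. *)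
Lemma coprimep_sqr_sub (p u v : {poly rat}) :
  separable_poly p -> u ^+ 2 - v ^+ 2 = p -> coprimep u v.
Proof.
move=> sep e; rewrite coprimep_def; apply: contraTT isT => g1.
have := separable_nosquare sep (isT : (1 < 2)%N) g1.
by rewrite -e dvdp_sub // dvdp_exp2r // ?dvdp_gcdl ?dvdp_gcdr.
Qed.

Definition half_poly : {poly rat} := (2%:R^-1)%:P.
Definition heron_pa : {poly rat} := 5%:R * 'X ^+ 2 - 4%:R * 'X + 4%:R.
Definition heron_pb : {poly rat} := half_poly * 'X * ('X ^+ 2 - 4%:R * 'X + 20%:R).
Definition heron_pc : {poly rat} := half_poly * ('X + 2%:R) * ('X ^+ 2 - 4%:R).

Lemma half_poly2 : half_poly * 2%:R = 1.
Proof. by rewrite /half_poly -(rmorph_nat (@polyC rat)) -polyCM mulVf. Qed.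

Lemma heron_acbE : heron_pa * (heron_pc - heron_pb) =
  (5%:R * 'X ^+ 2 - 4%:R * 'X + 4%:R) * (3%:R * 'X ^+ 2 - 12%:R * 'X - 4%:R).
Proof.
transitivity ((5%:R * 'X ^+ 2 - 4%:R * 'X + 4%:R)
  * ((half_poly * 2%:R) * (3%:R * 'X ^+ 2 - 12%:R * 'X - 4%:R))).
  by rewrite /heron_pa /heron_pb /heron_pc; ring.
by rewrite half_poly2 mul1r.
Qed.

Lemma heron_bcaE : 4%:R * (heron_pb * (heron_pc - heron_pa)) =
  'X * ('X ^+ 2 - 4%:R * 'X + 20%:R)
    * ('X ^+ 3 - 8%:R * 'X ^+ 2 + 4%:R * 'X - 16%:R).
Proof.
transitivity ((half_poly * 2%:R) * ('X * ('X ^+ 2 - 4%:R * 'X + 20%:R))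
  * ((half_poly * 2%:R) * (('X + 2%:R) * ('X ^+ 2 - 4%:R)) - 2%:R * heron_pa)).
  by rewrite /heron_pb /heron_pc; ring.
by rewrite half_poly2 !mul1r /heron_pa; ring.
Qed.

(* U^2, V^2, W^2 are the values x - e at the three roots e for x = x(2R), and
   the last hypothesis says that the tangent slope at 2R is integral. It forces
   W to be constant, and then V^2 has leading coefficient 15. *)
Lemma heron_no_halves (X U V W L : {poly rat}) :
  U ^+ 2 = X + heron_pb * heron_pc -> V ^+ 2 = X + heron_pa * heron_pc ->
  W ^+ 2 = X + heron_pa * heron_pb ->
  (U * V * W != 0 ->
   L * (4%:R * (U * V * W) ^+ 2) =
     ((U * V) ^+ 2 + (U * W) ^+ 2 + (V * W) ^+ 2) ^+ 2) -> False.
Proof.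
move=> eU eV eW eL.
have dV : V ^+ 2 - W ^+ 2 = (5%:R * 'X ^+ 2 - 4%:R * 'X + 4%:R)
    * (3%:R * 'X ^+ 2 - 12%:R * 'X - 4%:R).
  by rewrite -heron_acbE eV eW; ring.
have dU : (2%:R * U) ^+ 2 - (2%:R * W) ^+ 2 = 'X * ('X ^+ 2 - 4%:R * 'X + 20%:R)
    * ('X ^+ 3 - 8%:R * 'X ^+ 2 + 4%:R * 'X - 16%:R).
  by rewrite -heron_bcaE !exprMn eU eW; ring.
have Wconst : (size W <= 1)%N -> False.
  move/size1_polyC; move: (W`_0) => w wE.
  have : V ^+ 2 = 15%:R%:P * 'X ^+ 4
      + Poly [:: w ^+ 2 - 16%:R; - 32%:R; 40%:R; - 72%:R].
    rewrite -[V ^+ 2](subrK (W ^+ 2)) dV wE /= !cons_poly_def mul0r add0r.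
    by ring.
  by move/sqr_lead_coef => /(_ isT isT)/eqP; apply/negP/rat_sqr_neq15.
(* The cases where 2R has order 2. If U = 0, then (2W)^2 = -4 b (c - a) has leading coefficient -1;
   if V = 0, then W^2 has -15; W = 0 is a constant. *)
have [U0|U0] := eqVneq U 0.
  have : (2%:R * W) ^+ 2 = (- 1)%:P * 'X ^+ 6
      + Poly [:: 0; 320%:R; - 144%:R; 192%:R; - 56%:R; 12%:R].
    move: dU; rewrite U0 mulr0 expr0n sub0r => /(congr1 -%R); rewrite opprK => ->.
    rewrite /= !cons_poly_def mul0r add0r.
    by ring.
  move/sqr_lead_coef => /(_ isT isT) h; have := sqr_ge0 (lead_coef (2%:R * W)).
  by rewrite h.
have [V0|V0] := eqVneq V 0.
  have : W ^+ 2 = (- 15%:R)%:P * 'X ^+ 4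
      + Poly [:: 16%:R; 32%:R; - 40%:R; 72%:R].
    move: dV; rewrite V0 expr0n sub0r => /(congr1 -%R); rewrite opprK => ->.
    rewrite /= !cons_poly_def mul0r add0r.
    by ring.
  move/sqr_lead_coef => /(_ isT isT) h; have := sqr_ge0 (lead_coef W).
  by rewrite h oppr_ge0 lern0.
have [W0|W0] := eqVneq W 0; first by apply: Wconst; rewrite W0 size_poly0.
have two : 2%:R = 2%:R%:P :> {poly rat} by rewrite rmorph_nat.
have copU : coprimep W U.
  have := coprimep_sqr_sub separable_heron_bca dU.
  by rewrite two !mul_polyC coprimepZl // coprimepZr // coprimep_sym.
have copV : coprimep W V.
  by have := coprimep_sqr_sub separable_heron_acb dV; rewrite coprimep_sym.
apply: Wconst; rewrite leq_eqVlt; apply/orP; left.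
rewrite -coprimepp.
(* By integrality W divides this square, yet modulo W its base is (U V)^2, prime to W. So W is
   coprime to itself. *)
have dvW : W %| ((U * V) ^+ 2 + (U * W) ^+ 2 + (V * W) ^+ 2) ^+ 2.
  rewrite -eL ?mulf_neq0 // exprMn 2!mulrA; apply: dvdp_mull.
  by rewrite expr2 dvdp_mulIl.
apply: coprimep_dvdl dvW _; apply: coprimep_expr.
have -> : (U * V) ^+ 2 + (U * W) ^+ 2 + (V * W) ^+ 2 =
  (U ^+ 2 + V ^+ 2) * W * W + (U * V) ^+ 2 by ring.
by rewrite coprimep_addl_mul; apply: coprimep_expr; rewrite coprimepMr copU.
Qed.


(** * Doubling and 2-torsion when the cubic splits *)

Section SplitCubic.

Variables (F : fieldType) (E : ellCurve F) (d1 d2 d3 : F).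
Hypothesis E_split :
  E = ('X + d1%:P) * ('X + d2%:P) * ('X + d3%:P) :> {poly F}.

Lemma split_coef : [/\ E`_0 = d1 * d2 * d3,
  E`_1 = d1 * d2 + d1 * d3 + d2 * d3 & E`_2 = d1 + d2 + d3].
Proof.
have -> : E = 'X ^+ 3 + (d1 + d2 + d3)%:P * 'X ^+ 2
    + (d1 * d2 + d1 * d3 + d2 * d3)%:P * 'X + (d1 * d2 * d3)%:P :> {poly F}.
  by rewrite E_split; ring.
by split; rewrite !coefD !coefCM !coefXn coefX coefC /=; ring.
Qed.

Lemma split_horner x : E.[x] = (x + d1) * (x + d2) * (x + d3).
Proof. by rewrite E_split !hornerM !hornerD !hornerX !hornerC. Qed.

Lemma split_deriv x : (E^`()).[x] =
  (x + d1) * (x + d2) + (x + d1) * (x + d3) + (x + d2) * (x + d3).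
Proof. by have [_ E1 E2] := split_coef; rewrite cubic_derivE E1 E2; ring. Qed.

Lemma split_uniq : uniq [:: - d1; - d2; - d3].
Proof.
rewrite -separable_prod_XsubC !big_cons big_nil mulr1 !polyCN !opprK mulrA.
by rewrite -E_split; apply: cubic_separable.
Qed.

(** The identity behind 2-descent: at a double, the abscissa minus a root is a square. The roots are
    the [- d1], [- d2], [- d3]. *)
Lemma double_add_root x y l : y != 0 -> y ^+ 2 = E.[x] ->
    (E^`()).[x] = l * (2%:R * y) ->
  l ^+ 2 - E`_2 - x - x + d1 =
  (((x + d1) ^+ 2 - (d2 - d1) * (d3 - d1)) / (2%:R * y)) ^+ 2.
Proof.
move=> y0 e el; have n2 := ell_char E.
have z0 : 4%:R * y ^+ 2 != 0.
  by rewrite (natrM _ 2 2) !mulf_neq0 // expf_neq0.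
have [_ _ E2] := split_coef; apply: (mulIf z0).
transitivity ((l * (2%:R * y)) ^+ 2 - 4%:R * y ^+ 2 * (E`_2 + x + x - d1)).
  by ring.
transitivity (((x + d1) ^+ 2 - (d2 - d1) * (d3 - d1)) ^+ 2); last by field; rewrite y0.
by rewrite -el e E2 split_deriv split_horner; ring.
Qed.

Lemma raw_add_roots x1 x2 : x1 != x2 ->
  raw_add E (Some (x1, 0)) (Some (x2, 0)) = Some (- (d1 + d2 + d3) - x1 - x2, 0).
Proof.
have [_ _ E2] := split_coef => n12.
rewrite (@raw_add_chord _ _ _ _ _ _ 0) ?subrr ?mul0r // E2 subr0.
by rewrite expr0n /= sub0r.
Qed.

(** Affine points with y = 0 are the three roots, and two distinct ones add to the third; with
    infinity they form the Klein group. It remains to force y = 0 on torsion. *)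
Lemma two_torsion_embedding :
    (forall (P : point E) x y, torsion P -> val P = Some (x, y) -> y = 0) ->
  exists phi : 'Z_2 * 'Z_2 -> point E,
    [/\ injective phi,
        (forall u v : 'Z_2 * 'Z_2, phi (u + v) = addp (phi u) (phi v)) &
        (forall P, torsion P <-> exists u, phi u = P)].
Proof.
move=> tors0.
pose raw (u : 'Z_2 * 'Z_2) : option (F * F) :=
  if u.1 == 0 then (if u.2 == 0 then None else Some (- d2, 0))
  else (if u.2 == 0 then Some (- d1, 0) else Some (- d3, 0)).
have root0 d : d \in [:: d1; d2; d3] -> E.[- d] = 0.
  rewrite split_horner !inE => /or3P[] /eqP ->; rewrite addNr ?mulr0 ?mul0r //.
have rawP u : on_curve E (raw u).
  by rewrite /raw; case: ifP => _; case: ifP => _ //=;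
    rewrite expr0n root0 // !inE eqxx ?orbT.
have Z2 (i : 'Z_2) : i = 0 \/ i = 1.
  by case: i => [[|[|//]]] i2; [left | right]; apply: val_inj.
have := split_uniq; rewrite /= !inE negb_or andbT => /andP[/andP[n12 n13] n23].
have add2 u : raw_add E (raw u) (raw u) = None.
  by rewrite /raw; case: ifP => _; case: ifP => _ //=; rewrite oppr0 !eqxx.
have addC12 : - (d1 + d2 + d3) - - d1 - - d2 = - d3 by ring.
have addC13 : - (d1 + d2 + d3) - - d1 - - d3 = - d2 by ring.
have addC21 : - (d1 + d2 + d3) - - d2 - - d1 = - d3 by ring.
have addC23 : - (d1 + d2 + d3) - - d2 - - d3 = - d1 by ring.
have addC31 : - (d1 + d2 + d3) - - d3 - - d1 = - d2 by ring.
have addC32 : - (d1 + d2 + d3) - - d3 - - d2 = - d1 by ring.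
have r01 : raw (0, 1) = Some (- d2, 0) by [].
have r10 : raw (1, 0) = Some (- d1, 0) by [].
have r11 : raw (1, 1) = Some (- d3, 0) by [].
have raw_addE u v : raw (u + v) = raw_add E (raw u) (raw v).
  case: u v => [u1 u2] [v1 v2].
  case: (Z2 u1) => ->; case: (Z2 u2) => ->; case: (Z2 v1) => ->;
    case: (Z2 v2) => ->; rewrite ?add2 // ?(r01, r10, r11);
    rewrite ?raw_add_roots // 1?eq_sym //;
    by rewrite ?(addC12, addC13, addC21, addC23, addC31, addC32).
exists (fun u => Point (rawP u)); split.
- move=> [u1 u2] [v1 v2] /(congr1 val) /=.
  case: (Z2 u1) => ->; case: (Z2 u2) => ->; case: (Z2 v1) => ->;
    case: (Z2 v2) => -> //= [] /eqP; rewrite 1?[_ == - d1]eq_sym;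
    by rewrite ?[- d3 == - d2]eq_sym ?(negPf n12, negPf n13, negPf n23).
- by move=> u v; apply: val_inj; apply: raw_addE.
move=> P; split=> [tP|[u <-]]; last first.
  exists 2%N => //; apply: val_inj; rewrite /= -[RHS](add2 u).
  by case: (raw u) => [[]|].
case PE: (val P) => [[x y]|]; last by exists (0, 0); apply: val_inj; rewrite PE.
have y0 := tors0 _ _ _ tP PE; subst y.
have := valP P; rewrite PE /= expr0n split_horner eq_sym !mulf_eq0 -orbA !addr_eq0.
case/or3P=> /eqP xE.
- by exists (1, 0); apply: val_inj; rewrite PE xE.
- by exists (0, 1); apply: val_inj; rewrite PE xE.
- by exists (1, 1); apply: val_inj; rewrite PE xE.
Qed.

End SplitCubic.


(** * Torsion of the Heron curve *)

Section HeronTorsion.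

Variables (F : fieldType) (t : {rmorphism {poly rat} -> F}).
Hypothesis t_inj : injective t.
Hypothesis t_frac : forall x, exists p q : {poly rat}, q != 0 /\ x = t p / t q.

Lemma embed_half : t half_poly = 2%:R^-1.
Proof.
have h : t half_poly * 2%:R = 1 by rewrite -(rmorph_nat t) -rmorphM half_poly2 rmorph1.
have n2 : 2%:R != 0 :> F.
  by apply: contra_eqN h => /eqP ->; rewrite mulr0 eq_sym oner_eq0.
by apply: (mulIf n2); rewrite h mulVf.
Qed.

Lemma heron_aE : heron_a (t 'X) = t heron_pa.
Proof. by rewrite /heron_a /heron_pa rmorphD rmorphB !rmorphM !rmorph_nat expr2. Qed.

Lemma heron_bE : heron_b (t 'X) = t heron_pb.
Proof.
rewrite /heron_b /heron_pb -embed_half.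
by rewrite [RHS]rmorphM [t (half_poly * _)]rmorphM rmorphD rmorphB rmorphXn rmorphM !rmorph_nat.
Qed.

Lemma heron_cE : heron_c (t 'X) = t heron_pc.
Proof.
rewrite /heron_c /heron_pc -embed_half.
by rewrite [RHS]rmorphM [t (half_poly * _)]rmorphM rmorphD rmorphB rmorphXn !rmorph_nat.
Qed.

Variable E : ellCurve F.
Hypothesis E_heron : E = heron_cubic (t 'X) :> {poly F}.

Lemma heron_torsion_y0 (P : point E) x y :
  torsion P -> val P = Some (x, y) -> y = 0.
Proof.
move: E_heron; rewrite /heron_cubic heron_aE heron_bE heron_cE -!rmorphM.
set d1 := heron_pa * heron_pb; set d2 := heron_pb * heron_pc.
set d3 := heron_pa * heron_pc => E123 tP PE.
(* Permuting the factors lets [double_add_root] apply to each of the three roots. *)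
have E213 : E = ('X + (t d2)%:P) * ('X + (t d1)%:P) * ('X + (t d3)%:P) :> {poly F}.
  by rewrite E123; ring.
have E312 : E = ('X + (t d3)%:P) * ('X + (t d1)%:P) * ('X + (t d2)%:P) :> {poly F}.
  by rewrite E123; ring.
have [E0 E1 E2] := split_coef E123.
rewrite -?(rmorphM, rmorphD) in E0 E1 E2.
have n2 := ell_char E.
have tangent z w : w != 0 -> exists l, (E^`()).[z] = l * (2%:R * w).
  by move=> w0; exists ((E^`()).[z] / (2%:R * w)); rewrite divfK // mulf_neq0.
have [//|y0] := eqVneq y 0; exfalso.
have [l el] := tangent x y y0.
have := valP P; rewrite PE => /eqP onP.
have tD := torsion_double tP.
have DE : val (addp P P) =
    Some (l ^+ 2 - E`_2 - x - x, l * (x - (l ^+ 2 - E`_2 - x - x)) - y).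
  by rewrite -(raw_add_tangent y0 el) -PE.
have hW := double_add_root E123 y0 onP el.
have hU := double_add_root E213 y0 onP el.
have hV := double_add_root E312 y0 onP el.
move: hW hU hV DE; set x2 := _ - x - x; set y2 := _ - y.
set w := _ / _; set u := _ / _; set v := _ / _ => hW hU hV DE.
have [X xX] := torsion_integral t_inj t_frac E0 E1 E2 DE tD.
rewrite xX -!rmorphD in hW hU hV.
have [W wE] := sqrt_poly t_inj t_frac (esym hW).
have [U uE] := sqrt_poly t_inj t_frac (esym hU).
have [V vE] := sqrt_poly t_inj t_frac (esym hV).
rewrite wE -rmorphXn in hW; rewrite uE -rmorphXn in hU.
rewrite vE -rmorphXn in hV.
have [eW eU eV] := And3 (t_inj hW) (t_inj hU) (t_inj hV).
suff [L eL] : exists L, U * V * W != 0 -> L * (4%:R * (U * V * W) ^+ 2) =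
     ((U * V) ^+ 2 + (U * W) ^+ 2 + (V * W) ^+ 2) ^+ 2.
  by apply: (heron_no_halves (esym eU) (esym eV) (esym eW) eL).
(* If the product vanishes, the condition on [L] is vacuous and 0 is a placeholder. *)
have [|UVW0] := eqVneq (U * V * W) 0; first by exists 0.
have y2E : y2 ^+ 2 = t ((U * V * W) ^+ 2).
  have := valP (addp P P); rewrite DE => /eqP ->.
  rewrite (split_horner E123) xX -!rmorphD eW eU eV -!rmorphM.
  by congr (t _); ring.
have y20 : y2 != 0.
  by rewrite -sqrf_eq0 y2E embed_eq0 // sqrf_eq0.
have [m em] := tangent x2 y2 y20.
have DDE : val (addp (addp P P) (addp P P)) =
    Some (m ^+ 2 - E`_2 - x2 - x2, m * (x2 - (m ^+ 2 - E`_2 - x2 - x2)) - y2).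
  by rewrite -(raw_add_tangent y20 em) -DE.
have [X4 x4E] := torsion_integral t_inj t_frac E0 E1 E2 DDE (torsion_double tD).
(* The squared tangent slope at 2R, solved from the formula for x(4R); integrality of x(4R) makes it
   a polynomial. *)
pose L := X4 + (d1 + d2 + d3) + X + X.
have mL : m ^+ 2 = t L.
  by rewrite /L !(rmorphD t _ X) (rmorphD t X4) -x4E -E2 -xX; ring.
exists L => _; apply: t_inj; rewrite rmorphM -mL [t (4%:R * _)]rmorphM -y2E rmorph_nat.
(* The square of f'(x) = 2 m y at 2R, where f' is the sum of the pairwise products of U^2, V^2,
   W^2. *)
transitivity ((m * (2%:R * y2)) ^+ 2); first by ring.
rewrite -em (split_deriv E123) xX -!rmorphD eW eU eV -!rmorphM -!rmorphD -rmorphXn.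
by congr (t _); ring.
Qed.

Lemma heron_torsion : exists phi : 'Z_2 * 'Z_2 -> point E,
    [/\ injective phi,
        (forall u v : 'Z_2 * 'Z_2, phi (u + v) = addp (phi u) (phi v)) &
        (forall P, torsion P <-> exists u, phi u = P)].
Proof. exact: two_torsion_embedding E_heron heron_torsion_y0. Qed.

End HeronTorsion.

Theorem theorem2p1 :
  exists phi : 'Z_2 * 'Z_2 -> point heron_curve,
    [/\ injective phi,
        (forall u v : 'Z_2 * 'Z_2, phi (u + v) = addp (phi u) (phi v)) &
        (forall P, torsion P <-> exists u, phi u = P)].
Proof.
apply: (@heron_torsion Qk (@FracField.tofrac {poly rat})) => //.
- by move=> p q /eqP; rewrite tofrac_eq => /eqP.
- exact: frac_numden.
Qed.
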